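(* Let $P_4=\{123,132,321\}$ and $a_n=|A_n(P_4)|$. Then $a_1=1$, $a_2=3$, $a_3=12$, $a_4=51$, and for all $n\ge 5$ $$a_n=4a_{n-1}+2a_{n-2}-4a_{n-3}+a_{n-4}.$$
   Context: A Ferrers board $F$ with $n$ rows and $n$ columns is drawn in French notation: left- and bottom-justified, row lengths weakly increasing from top to bottom. $\mathcal{F}_n$ is the family of such boards containing the staircase board (i.e. the $i$-th row from the top has at least $i$ cells for every $i$). A transversal of $F$ is a placement of $1$'s in cells of $F$ with exactly one $1$ in each row and column. Columns are numbered left to right and heights bottom to top; $\pi_c$ is the height of the $1$ in column $c$. A transversal contains a pattern $p\in\mathfrak{S}_k$ if there are columns $c_1<\cdots<c_k$ such that $\pi_{c_1}\cdots\pi_{c_k}$ is order-isomorphic to $p$ and all $k^2$ cells in these columns and in the rows of these $1$'s lie in $F$; otherwise it avoids $p$. $A_n(P)$ is the set of pairs $(T,F)$ with $F\in\mathcal{F}_n$ and $T$ a transversal of $F$ avoiding every pattern in $P$. Under the standard correspondence, $a_n=|A_n(P)|=|\mathcal{M}_n(P)|$, where $\mathcal{M}_n(P)$ is the set of perfect matchings on $\{1,\dots,2n\}$ avoiding every $p\in P$. Here a matching contains $p\in\mathfrak{S}_3$ if it has three arcs $B_1,B_2,B_3$ with opening (smaller) vertices $o(B_1)<o(B_2)<o(B_3)$, all three opening vertices smaller than all three closing vertices, and $c(B_i)<c(B_j)\iff p_i>p_j$ for the closing vertices (so $123$ is three nested arcs and $321$ is three mutually crossing arcs). *)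

(* Defs.v *)
From mathcomp Require Import all_boot all_order all_algebra all_fingroup.

Set Implicit Arguments.
Unset Strict Implicit.
Unset Printing Implicit Defensive.

(* A board with n rows is given by its row lengths:
   [F i] is the number of cells in the row of index i counted from the TOP,
   starting at 0, so that the staircase condition reads [i < F i].
   Columns (from the left) and heights (from the bottom) also start at 0. *)
Definition board (n : nat) := {ffun 'I_n -> 'I_n.+1}.

Definition is_ferrers (n : nat) (F : board n) : bool :=
  [forall i : 'I_n, forall j : 'I_n, (i <= j) ==> (F i <= F j)].

Definition contains_staircase (n : nat) (F : board n) : bool :=
  [forall i : 'I_n, i < F i].

(* The staircase condition forces the bottom row to have exactly n cells, so
   these boards do have n columns. *)
Definition ferrers_family (n : nat) : {set board n} :=
  [set F | is_ferrers F && contains_staircase F].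

(* The row at height h is the row of index n - 1 - h from the top. *)
Definition in_board (n : nat) (F : board n) (c h : 'I_n) : bool :=
  c < F (rev_ord h).

(* A placement with exactly one 1 in each row and column is a permutation:
   [T c] is the height of the 1 in column c. *)
Definition is_transversal_of (n : nat) (F : board n) (T : 'S_n) : bool :=
  [forall c : 'I_n, in_board F c (T c)].

Definition contains_pattern (n k : nat) (F : board n) (T : 'S_n) (p : 'S_k) :
    bool :=
  [exists c : {ffun 'I_k -> 'I_n},
    [&& [forall i : 'I_k, forall j : 'I_k, (i < j) ==> (c i < c j)],
        [forall i : 'I_k, forall j : 'I_k,
           (T (c i) < T (c j)) == (p i < p j)]
      & [forall i : 'I_k, forall j : 'I_k, in_board F (c i) (T (c j))]]].

Definition avoiding_pairs (n k : nat) (P : {set 'S_k}) :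
    {set 'S_n * board n} :=
  [set TF | [&& TF.2 \in ferrers_family n,
                is_transversal_of TF.2 TF.1
              & [forall p in P, ~~ contains_pattern TF.2 TF.1 p]]].

Definition one_line (k : nat) (p : 'S_k) : seq nat :=
  [seq (p i).+1 | i : 'I_k].

Definition P4 : {set 'S_3} :=
  [set p | one_line p \in [:: [:: 1; 2; 3]; [:: 1; 3; 2]; [:: 3; 2; 1]]].

Definition a (n : nat) : nat := #|avoiding_pairs n P4|.

(* Main.v *)
Require Import Defs.
From mathcomp Require Import all_boot all_order all_algebra all_fingroup.
From mathcomp Require Import zify.
Import GRing.Theory Num.Theory.

Set Implicit Arguments.
Unset Strict Implicit.
Unset Printing Implicit Defensive.

(** Delete from a pair (T, F) of size n+1 the top row and the column c of its
    1.  What remains is a pair of size n, and the deletion loses exactly the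
    move (k, c), where k + 1 is the length of the top row: T is recovered by
    inserting a new maximal height at column c, and F by lengthening every row
    by one cell and putting a row of k + 1 cells on top.

    The top row is the shortest one, so the first k + 1 columns together with
    all rows form a full rectangle.  A forbidden pattern through the new 1
    lives in this rectangle, and it is excluded exactly when the first k
    heights of the smaller transversal decrease before column c, increase from
    column c on, and are larger before c than after ([extend_forbidden]).
    Three of these k heights must again avoid 123, 132 and 321, which by an
    Erdos-Szekeres type argument leaves only seven moves
    ([admitted_moves]).

    After the move (k, c) the relative order of the first k + 1 heights is
    known, so the moves admitted next depend on the last move and on nothing
    else ([extend_admits]).  Counting pairs by the move they admit is therefore
    a walk count in a fixed finite graph ([extend_count_rec]).  Moves with the
    same condition on the first heights have equal counts, so four numbers
    are left: a_n and the numbers p, q, r of pairs with a top row of length at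
    least 2, 2 or 3 whose first heights are ordered as 12, 21 or 312.  They
    satisfy, for n at least 1,
      a' = 3 a + p + 2 q + r,  p' = a + q + r,  q' = a + p + q,  r' = p,
    and the recurrence of the theorem is the characteristic equation of this
    4 by 4 system. *)

(** * Forbidden triples *)

(** One shape covers all three patterns: the first of three heights is the
    smallest (123 and 132), or the heights decrease (321).  Since a row that
    contains a cell of column [l] contains the cells to its left, the nine cells
    of an occurrence reduce to the three in its last column. *)
Definition forbidden (n : nat) (F : board n) (T : 'S_n) (i j l : 'I_n) : bool :=
  [&& i < j, j < l, in_board F l (T i), in_board F l (T j), in_board F l (T l)
    & (T i < T j) && (T i < T l) || (T l < T j) && (T j < T i)].

Lemma in_board_left (n : nat) (F : board n) (c d h : 'I_n) :
  c <= d -> in_board F d h -> in_board F c h.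
Proof. by rewrite /in_board; apply: leq_ltn_trans. Qed.

Local Notation o0 := (ord0 : 'I_3).
Local Notation o1 := (lift ord0 ord0 : 'I_3).
Local Notation o2 := (ord_max : 'I_3).

Lemma ord3P (Q : 'I_3 -> Prop) : Q o0 -> Q o1 -> Q o2 -> forall i, Q i.
Proof.
move=> q0 q1 q2 [[|[|[|//]]] lti].
- by congr Q: q0; apply: val_inj.
- by congr Q: q1; apply: val_inj.
- by congr Q: q2; apply: val_inj.
Qed.

Lemma one_line3 (p : 'S_3) : one_line p = [:: (p o0).+1; (p o1).+1; (p o2).+1].
Proof.
rewrite /one_line /image_mem !enum_ordSl enum_ord0 /=.
by do 3?[congr (_ :: _)]; congr (_ (p _)).+1; apply: val_inj.
Qed.

Lemma in_P4 (p : 'S_3) : (p \in P4) =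
  ((p o0 < p o1) && (p o0 < p o2) || (p o2 < p o1) && (p o1 < p o0)).
Proof.
rewrite inE one_line3 !inE !eqseq_cons !eqSS !andbT.
have p01 : p o0 != p o1 by rewrite (inj_eq perm_inj).
have p02 : p o0 != p o2 by rewrite (inj_eq perm_inj).
have p12 : p o1 != p o2 by rewrite (inj_eq perm_inj).
have := ltn_ord (p o0); have := ltn_ord (p o1); have := ltn_ord (p o2).
move: p01 p02 p12; rewrite -!val_eqE /=; lia.
Qed.

Lemma contains_forbidden (n : nat) (F : board n) (T : 'S_n) (p : 'S_3) :
  p \in P4 -> contains_pattern F T p -> exists i j l, forbidden F T i j l.
Proof.
rewrite in_P4 => p4 /existsP[c /and3P[inc ord cells]].
have {}inc (i j : 'I_3) : i < j -> c i < c j.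
  by move/forallP/(_ i)/forallP/(_ j)/implyP: inc.
have {}ord (i j : 'I_3) : (T (c i) < T (c j)) = (p i < p j).
  by move/forallP/(_ i)/forallP/(_ j)/eqP: ord.
have {}cells (i j : 'I_3) : in_board F (c i) (T (c j)).
  by move/forallP/(_ i)/forallP/(_ j): cells.
by exists (c o0), (c o1), (c o2); rewrite /forbidden !inc // !cells !ord.
Qed.

Lemma forbidden_contains (n : nat) (F : board n) (T : 'S_n) (i j l : 'I_n) :
  forbidden F T i j l -> exists2 p : 'S_3, p \in P4 & contains_pattern F T p.
Proof.
case/and5P=> ij jl iI jI /andP[lI vals].
have il := ltn_trans ij jl.
pose c := [ffun k : 'I_3 => tnth [tuple i; j; l] k].
have c0 : c o0 = i by rewrite ffunE.
have c1 : c o1 = j by rewrite ffunE.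
have c2 : c o2 = l by rewrite ffunE.
suff [p pOK] : exists p : 'S_3, forall u v, (T (c u) < T (c v)) = (p u < p v).
  exists p; first by rewrite in_P4 -!pOK c0 c1 c2.
  apply/existsP; exists c; apply/and3P; split.
  - apply/forallP=> u; apply/forallP=> v; move: u v.
    by apply: ord3P; apply: ord3P; rewrite ?c0 ?c1 ?c2 //=.
  - by apply/forallP=> u; apply/forallP=> v; rewrite pOK.
  - apply/forallP=> u; apply/forallP=> v; move: u v.
    by apply: ord3P; apply: ord3P; rewrite ?c0 ?c1 ?c2;
      rewrite ?(in_board_left (ltnW ij)) ?(in_board_left (ltnW jl))
              ?(in_board_left (ltnW il)).
have ne (u v : 'I_n) : u < v -> T u != T v :> nat.
  by rewrite (inj_eq val_inj) (inj_eq perm_inj) -val_eqE; case: ltngtP.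
(* the three surviving orders are 123, 132 and 321 *)
move: vals (ne _ _ ij) (ne _ _ jl) (ne _ _ il).
case: (ltngtP (T i) (T j)); case: (ltngtP (T j) (T l)); case: (ltngtP (T i) (T l));
  move=> //= A B C _ _ _ _; try lia;
  [exists 1%g | exists (tperm o1 o2) | exists (tperm o0 o2)];
  by apply: ord3P; apply: ord3P; rewrite ?c0 ?c1 ?c2 ?permE /= /bump /=; lia.
Qed.

Lemma avoids_P4E (n : nat) (F : board n) (T : 'S_n) :
  [forall p in P4, ~~ contains_pattern F T p]
  = [forall i, forall j, forall l, ~~ forbidden F T i j l].
Proof.
apply/forall_inP/forallP => [av i | av p pP].
  apply/forallP=> j; apply/forallP=> l; apply/negP.
  by case/forbidden_contains=> p /av/negP.
apply/negP=> /(contains_forbidden pP)[i [j [l bad]]].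
by have /forallP/(_ j)/forallP/(_ l)/negP := av i.
Qed.

(** * Inserting a top row *)

(** The condition for putting a row of [k + 1] cells on top once all rows are
    lengthened by one cell.  The empty board has no row to enforce [k <= n], so
    this is asked separately. *)
Definition rows_at_least (n k : nat) (F : board n) : bool :=
  (k <= n) && [forall r : 'I_n, k <= F r].

(** Among the first [k] heights, those before column [c] decrease and exceed
    all the later ones, and those from [c] on increase: an ascent [i < j] occurs
    exactly when both columns are at or after [c]. *)
Definition splits_at (n k c : nat) (T : 'S_n) : bool :=
  [forall i : 'I_n, forall j : 'I_n, (i < j < k) ==> ((T i < T j) == (c <= i))].

Lemma forbidden_freeP (n : nat) (F : board n) (T : 'S_n) :
  reflect (forall i j l, ~~ forbidden F T i j l)
          [forall i, forall j, forall l, ~~ forbidden F T i j l].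
Proof.
apply: (iffP forallP) => [H i j l | H i].
  by have /forallP/(_ j)/forallP/(_ l) := H i.
by apply/forallP=> j; apply/forallP=> l; apply: H.
Qed.

Lemma splits_atP (n k c : nat) (T : 'S_n) :
  reflect (forall i j : 'I_n, i < j -> j < k -> (T i < T j) = (c <= i))
          (splits_at k c T).
Proof.
apply: (iffP forallP) => [H i j ij jk | H i].
  by have /forallP/(_ j)/implyP/(_ _)/eqP := H i; apply; rewrite ij.
by apply/forallP=> j; apply/implyP=> /andP[ij jk]; apply/eqP/H.
Qed.

Definition add_row (n k : nat) (F : board n) : board n.+1 :=
  [ffun r => if unlift ord0 r is Some r' then lift ord0 (F r') else inord k.+1].

Definition extend (n k : nat) (c : 'I_n.+1) (y : 'S_n * board n) :
    'S_n.+1 * board n.+1 :=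
  (lift_perm c ord_max y.1, add_row k y.2).

Lemma add_row_top (n k : nat) (F : board n) : k <= n -> add_row k F ord0 = k.+1 :> nat.
Proof. by move=> kn; rewrite ffunE unlift_none inordK. Qed.

Lemma add_row_lift (n k : nat) (F : board n) (r : 'I_n) :
  add_row k F (lift ord0 r) = (F r).+1 :> nat.
Proof. by rewrite ffunE liftK lift0. Qed.

Lemma ferrersP (n : nat) (F : board n) :
  reflect ((forall i j : 'I_n, i <= j -> F i <= F j) /\ forall i : 'I_n, i < F i)
          (F \in ferrers_family n).
Proof.
rewrite inE; apply: (iffP andP) => [[/forallP H /forallP K] | [H K]].
  by split=> // i j; have /forallP/(_ j)/implyP := H i.
by split; apply/forallP=> i //; apply/forallP=> j; apply/implyP/H.
Qed.

Lemma lift_ltn (n : nat) (h : 'I_n.+1) (i j : 'I_n) :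
  (lift h i < lift h j) = (i < j).
Proof. by rewrite !ltnNge leq_bump2. Qed.

Lemma rev_lift_max (n : nat) (i : 'I_n) :
  rev_ord (lift ord_max i) = lift ord0 (rev_ord i).
Proof. by apply: val_inj; rewrite /= /bump /=; have := ltn_ord i; lia. Qed.

Lemma rev_ord_max (n : nat) : rev_ord ord_max = ord0 :> 'I_n.+1.
Proof. by apply: val_inj; rewrite /= subnn. Qed.

Section Extend.
Variables (n k : nat) (c : 'I_n.+1) (T : 'S_n) (F : board n).
Hypotheses (ck : c <= k) (fit : rows_at_least k F).
Let T1 := lift_perm c ord_max T.
Let F1 := add_row k F.

Let kn : k <= n. Proof. by case/andP: fit. Qed.
Let kF (r : 'I_n) : k <= F r. Proof. by case/andP: fit => _ /forallP. Qed.

Lemma in_board_top (d : 'I_n.+1) : in_board F1 d (T1 c) = (d <= k).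
Proof. by rewrite /in_board /T1 lift_perm_id rev_ord_max add_row_top. Qed.

Lemma in_board_new (d : 'I_n) : in_board F1 c (T1 (lift c d)).
Proof.
rewrite /in_board /T1 lift_perm_lift rev_lift_max add_row_lift.
by rewrite ltnS (leq_trans ck).
Qed.

(** Every row reaches column [c], because [c <= k].  An old column to the right
    of [c] is therefore shifted together with the end of the row, and one to the
    left of [c] lies in the row both before and after. *)
Lemma in_board_old (d e : 'I_n) :
  in_board F1 (lift c d) (T1 (lift c e)) = in_board F d (T e).
Proof.
rewrite /in_board /T1 lift_perm_lift rev_lift_max add_row_lift /= /bump.
by have := kF (rev_ord (T e)); lia.
Qed.

Lemma forbidden_old (i j l : 'I_n) :
  forbidden F1 T1 (lift c i) (lift c j) (lift c l) = forbidden F T i j l.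
Proof.
by rewrite /forbidden !lift_ltn !in_board_old !lift_perm_lift !lift_ltn.
Qed.

Lemma add_row_ferrers : (F1 \in ferrers_family n.+1) = (F \in ferrers_family n).
Proof.
apply/ferrersP/ferrersP => -[mono stair]; split.
- by move=> i j ij; have := mono (lift ord0 i) (lift ord0 j);
    rewrite !add_row_lift !lift0; apply.
- by move=> i; have := stair (lift ord0 i); rewrite add_row_lift lift0.
- move=> i j; case: (unliftP ord0 i) => [i' ->|->]; case: (unliftP ord0 j) => [j' ->|->];
    rewrite ?add_row_lift ?add_row_top ?lift0 ?ltnS //.
  exact: mono.
by move=> i; case: (unliftP ord0 i) => [i' ->|->];
  rewrite ?add_row_lift ?add_row_top ?lift0 ?ltnS.
Qed.

Lemma extend_transversal : is_transversal_of F1 T1 = is_transversal_of F T.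
Proof.
apply/forallP/forallP => H d; first by rewrite -in_board_old.
case: (unliftP c d) => [d' ->|->]; first by rewrite in_board_old.
by rewrite in_board_top.
Qed.

(** The new 1 is the highest, so it completes an ascent of old heights to 123
    from the right or to 132 from the middle, and a descent to 321 from the
    left.  Its row confines such an occurrence to the first [k + 1]
    columns, where every cell is present; excluding the three cases for old
    columns [i < j < k] says that an ascent requires [c <= i] and a descent
    [i < c]. *)
Lemma extend_forbidden :
  [forall i, forall j, forall l, ~~ forbidden F1 T1 i j l] =
  [forall i, forall j, forall l, ~~ forbidden F T i j l] && splits_at k c T.
Proof.
have old_top (i j : 'I_n) : i < k -> in_board F1 (lift c i) (T1 (lift c j)).
  by move=> ik; rewrite in_board_old; apply: leq_trans (kF _).
have new_top (i : 'I_n) : i < k -> in_board F1 (lift c i) (T1 c).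
  by move=> ik; rewrite in_board_top; apply: leq_trans ik; rewrite /= /bump; lia.
have c_lift (i : 'I_n) : (c < lift c i) = (c <= i) by rewrite /= /bump; lia.
have lift_c (i : 'I_n) : (lift c i < c) = (i < c) by rewrite /= /bump; lia.
have lift_k (i : 'I_n) : c <= i -> lift c i <= k -> i < k by rewrite /= /bump; lia.
have T1c : T1 c = ord_max by rewrite /T1 lift_perm_id.
have T1l (i : 'I_n) : T1 (lift c i) = T i :> nat by rewrite /T1 lift_perm_lift lift_max.
apply/forbidden_freeP/andP => [av | [/forbidden_freeP av /splits_atP sp]].
  split; first by apply/forbidden_freeP => i j l; rewrite -forbidden_old.
  apply/splits_atP=> i j ij jk.
  have ik := ltn_trans ij jk.
  have Tij : T i != T j :> nat.
    by rewrite (inj_eq val_inj) (inj_eq perm_inj) -val_eqE; case: ltngtP ij.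
  have Ti := ltn_ord (T i); have Tj := ltn_ord (T j).
  (* exactly one of these three triples has increasing columns *)
  have := av c (lift c i) (lift c j); have := av (lift c i) c (lift c j).
  have := av (lift c i) (lift c j) c.
  rewrite /forbidden !old_top // !new_top // !in_board_new in_board_top ck.
  rewrite !lift_ltn !c_lift !lift_c ij T1c !T1l /=.
  lia.
move=> i j l; apply/negP.
case: (unliftP c i) => [i' ->|->]; case: (unliftP c j) => [j' ->|->];
  case: (unliftP c l) => [l' ->|->].
all: rewrite ?forbidden_old ?(negbTE (av _ _ _)) //.
all: rewrite /forbidden ?lift_ltn ?c_lift ?lift_c ?ltnn ?andbF //=.
all: rewrite ?in_board_top ?T1c ?T1l.
- case/and5P=> ij jc _ _ /andP[_]; have := sp i' j' ij (leq_trans jc ck).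
  by have := ltn_ord (T j'); rewrite /=; lia.
- case/and5P=> ic cl _ lk /andP[_]; have := sp i' l' (leq_trans ic cl) (lift_k _ cl lk).
  by have := ltn_ord (T i'); rewrite /=; lia.
- case/and5P=> cj jl lk _ /andP[_].
  have := sp j' l' jl (lift_k _ (leq_trans cj (ltnW jl)) lk).
  by have := ltn_ord (T j'); rewrite /=; lia.
- by lia.
Qed.
End Extend.

(** * Moves *)

Local Notation avoiders n := (avoiding_pairs n P4).

Lemma mem_avoiders (n : nat) (x : 'S_n * board n) :
  (x \in avoiders n) =
  [&& x.2 \in ferrers_family n, is_transversal_of x.2 x.1
    & [forall i, forall j, forall l, ~~ forbidden x.2 x.1 i j l]].
Proof. by rewrite inE avoids_P4E. Qed.

Definition admits (n : nat) (m : nat * nat) (y : 'S_n * board n) : bool :=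
  [&& m.2 <= m.1, rows_at_least m.1 y.2 & splits_at m.1 m.2 y.1].

(** The length of the top row is stored minus one, in accordance with the
    parameter [k] of [extend]. *)
Definition move_of (n : nat) (x : 'S_n.+1 * board n.+1) : nat * nat :=
  ((x.2 ord0).-1, (x.1^-1)%g ord_max : nat).

Lemma mem_extend (n k : nat) (c : 'I_n.+1) (y : 'S_n * board n) :
  c <= k -> rows_at_least k y.2 ->
  (extend k c y \in avoiders n.+1) = (y \in avoiders n) && splits_at k c y.1.
Proof.
move=> ck fit; rewrite !mem_avoiders add_row_ferrers // extend_transversal //.
by rewrite extend_forbidden // -!andbA.
Qed.

Lemma move_of_extend (n k : nat) (c : 'I_n.+1) (y : 'S_n * board n) :
  k <= n -> move_of (extend k c y) = (k, c : nat).
Proof. by move=> kn; rewrite /move_of lift_permV lift_perm_id /= add_row_top. Qed.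

Lemma extend_inj (n k : nat) (c : 'I_n.+1) : injective (@extend n k c).
Proof.
move=> [T F] [T' F'] [/permP eT /ffunP eF]; congr (_, _).
  apply/permP=> i; have := eT (lift c i).
  by rewrite !lift_perm_lift => /lift_inj.
apply/ffunP=> r; have /(congr1 val) := eF (lift ord0 r).
by rewrite /= !add_row_lift => -[/val_inj].
Qed.

Lemma extend_surj (n : nat) (x : 'S_n.+1 * board n.+1) :
  x \in avoiders n.+1 -> exists (c : 'I_n.+1) (y : 'S_n * board n),
    [/\ c <= (move_of x).1, c = (move_of x).2 :> nat,
        rows_at_least (move_of x).1 y.2 & x = extend (move_of x).1 c y].
Proof.
case: x => T F; rewrite mem_avoiders => /and3P[/= /ferrersP[mono stair] /forallP tr _].
set c := (T^-1)%g ord_max; set k := (F ord0).-1.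
have Tc : T c = ord_max by rewrite permKV.
have F0 : F ord0 = k.+1 :> nat by rewrite /k prednK //; apply: stair.
have Fpos (r : 'I_n.+1) : k < F r by rewrite -F0; apply: mono.
have Tne (i : 'I_n) : ord_max != T (lift c i).
  by rewrite -Tc (inj_eq perm_inj) neq_lift.
pose f (i : 'I_n) := odflt i (unlift ord_max (T (lift c i))).
have fE (i : 'I_n) : lift ord_max (f i) = T (lift c i).
  by rewrite /f; case: (unlift_some (Tne i)) => j -> ->.
have f_inj : injective f.
  by move=> i j /(congr1 (lift ord_max)); rewrite !fE => /perm_inj/lift_inj.
pose F' : board n := [ffun r => inord (F (lift ord0 r)).-1].
have F'E (r : 'I_n) : (F' r).+1 = F (lift ord0 r) :> nat.
  have := Fpos (lift ord0 r); have := ltn_ord (F (lift ord0 r)).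
  by rewrite ffunE => Fn kF; rewrite inordK; lia.
have kn : k <= n by have := ltn_ord (F ord0); rewrite F0.
exists c, (perm f_inj, F'); split=> //=.
- by have := tr c; rewrite /in_board Tc rev_ord_max F0.
- by apply/andP; split=> //; apply/forallP=> r; rewrite -ltnS F'E.
congr (_, _).
  apply/permP=> i; case: (unliftP c i) => [i' ->|->].
    by rewrite lift_perm_lift permE fE.
  by rewrite lift_perm_id.
apply/ffunP=> r; apply: val_inj; case: (unliftP ord0 r) => [r' ->|->] /=.
  by rewrite add_row_lift F'E.
by rewrite add_row_top.
Qed.

(** By the new top row of length [k + 1], the order of the first [k + 1] heights
    after these moves is 1; 21 and 12; 312, 231 and 213; 3412. *)
Definition moves : seq (nat * nat) :=
  [:: (0, 0); (1, 0); (1, 1); (2, 0); (2, 1); (2, 2); (3, 1)].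

(** Three columns [i < j < l] among the first [k] neither have the smallest
    height first nor decrease, and the splitting at [c] translates this into
    [i < c <= j].  The triple 0, 1, 2 forces [c = 1], and 1, 2, 3 would force
    [c = 2]; hence [k <= 2], or [k = 3] and [c = 1]. *)
Lemma admitted_moves (n : nat) (m : nat * nat) (y : 'S_n * board n) :
  y \in avoiders n -> admits m y -> m \in moves.
Proof.
case: m => k c; rewrite mem_avoiders => /and3P[_ _ /forbidden_freeP free].
case/and3P=> /= ck /andP[kn /forallP kF] /splits_atP sp.
have between (i j l : nat) : i < j -> j < l -> l < k -> i < c <= j.
  move=> ij jl lk; have il := ltn_trans ij jl.
  have ln := leq_trans lk kn; have jn := ltn_trans jl ln.
  pose I := Ordinal (ltn_trans ij jn); pose J := Ordinal jn; pose L := Ordinal ln.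
  have TIJ : y.1 I != y.1 J :> nat.
    by rewrite (inj_eq val_inj) (inj_eq perm_inj) -val_eqE neq_ltn ij.
  have TJL : y.1 J != y.1 L :> nat.
    by rewrite (inj_eq val_inj) (inj_eq perm_inj) -val_eqE neq_ltn jl.
  have := free I J L; rewrite /forbidden /in_board !(leq_trans lk (kF _)) /=.
  have := sp I J ij (ltn_trans jl lk); have := sp I L il lk.
  by have := sp J L jl lk; rewrite /= ij jl /=; lia.
case: (leqP k 2) => [k2 | k3].
  by rewrite !inE !xpair_eqE; lia.
have /= := between 0 1 2 isT isT k3.
case: (leqP k 3) => [k3' | k4]; first by rewrite !inE !xpair_eqE; lia.
have /= := between 1 2 3 isT isT k4; lia.
Qed.

Definition extend_count (n : nat) (m : nat * nat) : nat :=
  #|[set y in avoiders n | admits m y]|.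

Lemma card_move (n : nat) (m : nat * nat) :
  #|[set x in avoiders n.+1 | move_of x == m]| = extend_count n m.
Proof.
case: m => k c; rewrite /extend_count -(card_imset _ (@extend_inj n k (inord c))).
congr #|pred_of_set _|; apply/setP=> x.
apply/setIdP/imsetP => [[xA /eqP xm] | [y]].
  have [d [y [dk dc fit xE]]] := extend_surj xA.
  rewrite xm /= in dk dc fit xE.
  have -> : inord c = d :> 'I_n.+1 by rewrite -dc inord_val.
  exists y => //; move: xA; rewrite xE mem_extend // => /andP[yA sp].
  by apply/setIdP; split=> //; rewrite /admits /= -dc dk fit.
case/setIdP=> yA /and3P[/= ck fit sp] ->.
have kn : k <= n by case/andP: fit.
have cE : (inord c : 'I_n.+1) = c :> nat by rewrite inordK // ltnS (leq_trans ck).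
by rewrite mem_extend ?cE // yA sp move_of_extend // cE.
Qed.

(** * The transfer system *)

(** Whether [m'] is admitted right after [m].  After the move [(k, c)] the 1 of
    column [c] is the highest of the first [k + 1], and the other heights are
    split at [c]; so for [i < j <= k] column [j] is higher than column [i] iff
    [j = c] or [c < i].  The condition compares this with the splitting that
    [m'] requires. *)
Definition compatible (m m' : nat * nat) : bool :=
  [&& m'.2 <= m'.1, m'.1 <= m.1.+1 &
    all (fun j => all (fun i => ((j == m.2) || (m.2 < i)) == (m'.2 <= i))
                      (iota 0 j)) (iota 0 m'.1)].

Lemma extend_admits (n k : nat) (c : 'I_n.+1) (y : 'S_n * board n)
    (m' : nat * nat) :
  admits (k, c : nat) y -> extend k c y \in avoiders n.+1 ->
  admits m' (extend k c y) = compatible (k, c : nat) m'.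
Proof.
case: m' => k' c'; case/and3P=> /= ck fit /splits_atP sp.
rewrite mem_avoiders => /and3P[/= /ferrersP[mono _] _ _].
have kn : k <= n by case/andP: fit.
have top (i j : 'I_n.+1) : i < j -> j <= k ->
    (lift_perm c ord_max y.1 i < lift_perm c ord_max y.1 j) = (j == c) || (c < i).
  case: (unliftP c i) => [i' ->|->]; case: (unliftP c j) => [j' ->|->].
  - rewrite lift_ltn !lift_perm_lift lift_ltn => ij jk.
    rewrite sp //; first by rewrite -val_eqE /= /bump; lia.
    by move: jk; rewrite /= /bump; lia.
  - rewrite lift_perm_lift lift_perm_id eqxx lift_max => _ _.
    exact: ltn_ord.
  - rewrite lift_perm_lift lift_perm_id lift_max ltnn orbF.
    by rewrite -val_eqE /= /bump; have := ltn_ord (y.1 j'); lia.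
  - by rewrite ltnn.
rewrite /admits /compatible /=; congr (_ && _).
have -> : rows_at_least k' (add_row k y.2) = (k' <= k.+1).
  apply/andP/idP => [[_ /forallP/(_ ord0)] | k'k]; first by rewrite add_row_top.
  split; first exact: leq_trans k'k _.
  apply/forallP=> r; apply: leq_trans (mono ord0 r _) => //.
  by rewrite add_row_top.
case: leqP => //= k'k.
have k'n : k' <= n.+1 by apply: leq_trans k'k _.
apply/splits_atP/allP => [H j | H i j ij jk'].
  rewrite mem_iota /= => jk'; have jn := leq_trans jk' k'n.
  apply/allP=> i; rewrite mem_iota /= => ij.
  have := H (Ordinal (ltn_trans ij jn)) (Ordinal jn) ij jk'.
  rewrite top //=; last by rewrite -ltnS (leq_trans jk').
  by rewrite -val_eqE /= => ->.
rewrite top //; last by rewrite -ltnS (leq_trans jk').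
have jk'_iota : (j : nat) \in iota 0 k' by rewrite mem_iota.
have := allP (H _ jk'_iota) i; rewrite mem_iota => /(_ ij)/eqP <-.
by rewrite -val_eqE.
Qed.

(** Sort the pairs of size [n + 1] by the move that created them; within one
    class either all pairs admit [m'] or none does. *)
Lemma extend_count_rec (n : nat) (m' : nat * nat) :
  extend_count n.+1 m' =
  \sum_(m <- moves) compatible m m' * extend_count n m.
Proof.
have classes (x : 'S_n.+1 * board n.+1) : x \in avoiders n.+1 ->
    (move_of x \in moves) && (admits m' x == compatible (move_of x) m').
  move=> xA; have [c [y [ck cE fit xE]]] := extend_surj xA.
  move: xA; rewrite {1}xE mem_extend // => /andP[yA sp].
  have adm : admits (move_of x) y by rewrite /admits -cE ck fit.
  rewrite (admitted_moves yA adm) /=.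
  have mE : move_of x = ((move_of x).1, c : nat) by rewrite cE -surjective_pairing.
  by rewrite {1}xE mE extend_admits -?mE // mem_extend // yA.
rewrite {1}/extend_count -sum1_card big_mkcond /=.
under [RHS]eq_bigr => m _ do rewrite -card_move -sum1_card big_distrr /= big_mkcond /=.
rewrite exchange_big /=; apply: eq_bigr => x _.
have inId (Q : pred _) : (x \in [set z in avoiders n.+1 | Q z])
    = (x \in avoiders n.+1) && Q x by apply/setIdP/andP.
rewrite inId; case: (boolP (x \in avoiders n.+1)) => /= xA; last first.
  by rewrite big1 // => m _; rewrite inId (negbTE xA).
have /andP[xm /eqP ->] := classes x xA.
rewrite (bigD1_seq _ xm) //= inId xA eqxx muln1 big1 ?addn0; last first.
  by move=> m mx; rewrite inId xA eq_sym (negbTE mx).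
by case: compatible.
Qed.

Lemma avoiders0 : #|avoiders 0| = 1.
Proof.
apply: (@eq_card1 _ (1%g, [ffun=> ord0])) => -[T F].
rewrite mem_avoiders !inE -/(is_ferrers _).
have -> : T = 1%g by apply/permP; case.
have -> : F = [ffun=> ord0] by apply/ffunP; case.
rewrite eqxx; apply/and3P; split; first by apply/andP; split; apply/forallP; case.
  by apply/forallP; case.
by apply/forallP; case.
Qed.

Lemma extend_count0 (m : nat * nat) : m \in moves -> extend_count 0 m = (m == (0, 0)).
Proof.
move=> mm; rewrite /extend_count; case: (m =P (0, 0)) => [-> | /eqP m0] /=.
  apply: etrans avoiders0; congr #|pred_of_set _|; apply/setP=> y; apply/setIdP/idP.
    by case.
  by split=> //; rewrite /admits /rows_at_least /=; apply/andP; split; apply/forallP; case.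
apply: eq_card0 => y; apply/setIdP => -[_ /and3P[_ /andP[k0 _] _]].
by move: m0 k0; move: mm; case: m => k c; rewrite !inE !xpair_eqE /=; lia.
Qed.

Lemma extend_count00 (n : nat) : extend_count n (0, 0) = a n.
Proof.
congr #|pred_of_set _|; apply/setP=> y; apply/setIdP/idP; first by case.
split=> //; apply/and3P; split=> //; first by apply/andP; split=> //; apply/forallP.
by apply/splits_atP.
Qed.

(** The moves (1, 0) and (1, 1) are admitted under the same condition, and so
    are (2, 1) and (2, 2), which reduces the seven counts to five.  The count
    [s] is [a n] as soon as [n] is positive; keeping it apart lets the system
    start from the empty board. *)
Lemma a_system (n : nat) :
  let s := extend_count n (1, 0) in let p := extend_count n (2, 0) in
  let q := extend_count n (2, 1) in let r := extend_count n (3, 1) in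
  [/\ a n.+1 = a n + 2 * s + p + 2 * q + r,
      extend_count n.+1 (1, 0) = a n.+1,
      extend_count n.+1 (2, 0) = s + q + r,
      extend_count n.+1 (2, 1) = s + p + q
    & extend_count n.+1 (3, 1) = p].
Proof.
have [same11 same22] : extend_count n (1, 1) = extend_count n (1, 0) /\
    extend_count n (2, 2) = extend_count n (2, 1).
  case: n => [|n]; first by rewrite !extend_count0.
  by rewrite !extend_count_rec /moves !big_cons !big_nil.
rewrite -!extend_count00 !extend_count_rec /moves !big_cons !big_nil /= same11 same22.
by split; lia.
Qed.

Lemma a0 : a 0 = 1. Proof. exact: avoiders0. Qed.

Theorem theorem24 :
  [/\ a 1 = 1, a 2 = 3, a 3 = 12, a 4 = 51
    & forall n : nat, 5 <= n ->
      ((a n)%:Z = 4 * (a (n - 1))%:Z + 2 * (a (n - 2))%:Z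
                  - 4 * (a (n - 3))%:Z + (a (n - 4))%:Z)%R].
Proof.
have [p0 s0 q0 r0] : [/\ extend_count 0 (2, 0) = 0, extend_count 0 (1, 0) = 0,
    extend_count 0 (2, 1) = 0 & extend_count 0 (3, 1) = 0].
  by split; rewrite extend_count0.
have [e0 s1 p1 q1 r1] := a_system 0; have [e1 s2 p2 q2 r2] := a_system 1.
have [e2 s3 p3 q3 r3] := a_system 2; have [e3 _ _ _ _] := a_system 3.
have := a0; split; try lia.
move=> [|[|[|[|[|n]]]]] // _; rewrite !subSS !subn0.
(* elimination of s, p, q, r from the system over four consecutive steps *)
have [_ t0 _ _ _] := a_system n.
have [f0 t1 u0 v0 w0] := a_system n.+1; have [f1 t2 u1 v1 w1] := a_system n.+2.
have [f2 t3 u2 v2 w2] := a_system n.+3; have [f3 _ _ _ _] := a_system n.+4.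
lia.
Qed.
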